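(* Let $X$ be a smooth complete toric variety of dimension $d\ge5$ over an algebraically closed field with Picard number $\rho(X)=2$. Then $\mathrm{ch}_4(X)$ is not positive.
   Context: For a smooth complete toric variety $X$ of dimension $d$ with torus invariant prime divisors $D_1,\dots,D_n$, $\mathrm{ch}_k(X)=\frac{1}{k!}\sum_i D_i^k$. For $1\le k\le d$, $\mathrm{ch}_k(X)$ is positive if $(\mathrm{ch}_k(X)\cdot Y)>0$ for every $k$-dimensional torus invariant irreducible closed subvariety $Y\subset X$. *)

(* Defs.v *)
From HB Require Import structures.
From mathcomp Require Import all_boot all_order all_algebra.
Set Implicit Arguments. Unset Strict Implicit. Unset Printing Implicit Defensive.
Import Order.TTheory GRing.Theory Num.Theory.
Local Open Scope ring_scope.

(* Rays v i in the lattice N = Z^d; cones are sets of ray indices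
   (all cones of a smooth fan are simplicial). *)

Definition rayQ (d n : nat) (v : 'I_n -> 'rV[int]_d) (i : 'I_n) : 'rV[rat]_d :=
  map_mx (fun z : int => z%:~R) (v i).

Definition in_cone (d n : nat) (v : 'I_n -> 'rV[int]_d) (s : {set 'I_n})
  (x : 'rV[rat]_d) : Prop :=
  exists c : 'I_n -> rat, (forall i, 0 <= c i) /\
    x = \sum_(i in s) c i *: rayQ v i.

Definition Z_basis (d n : nat) (v : 'I_n -> 'rV[int]_d) (s : {set 'I_n}) : Prop :=
  #|s| = d /\
  forall x : 'rV[int]_d, exists c : 'I_n -> int, x = \sum_(i in s) c i *: v i.

Definition smooth_complete_fan (d n : nat) (v : 'I_n -> 'rV[int]_d)
  (F : {set {set 'I_n}}) : Prop :=
  (forall s t : {set 'I_n}, s \in F -> t \subset s -> t \in F) /\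
  (forall i, [set i] \in F) /\
  (forall s : {set 'I_n}, s \in F -> exists2 t : {set 'I_n}, t \in F & (s \subset t /\ Z_basis v t)) /\
  (forall s t : {set 'I_n}, s \in F -> t \in F -> forall x,
      in_cone v s x -> in_cone v t x -> in_cone v (s :&: t) x) /\
  (* completeness: the support is all of N_R (tested on rational points) *)
  (forall x : 'rV[rat]_d, exists2 s : {set 'I_n}, s \in F & in_cone v s x).

Definition picard_number (d n : nat) : nat := (n - d)%N.

(* monomial D^e := prod_i D_i^(e i), encoded by its exponent vector *)
Definition incr_exp (n : nat) (e : {ffun 'I_n -> nat}) (i : 'I_n)
  : {ffun 'I_n -> nat} := [ffun j => (e j + (j == i))%N].

Definition indic_exp (n : nat) (s : {set 'I_n}) : {ffun 'I_n -> nat} :=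
  [ffun j => nat_of_bool (j \in s)].

(* deg computes the intersection numbers deg(D^e) = (D_1^e_1 ... D_n^e_n)
   for monomials of degree d: it satisfies the Stanley-Reisner relations,
   the linear relations sum_i <m, v_i> D_i = 0, and the normalisation
   (product of the divisors of a maximal cone = class of a point).
   These characterise the intersection numbers uniquely on a smooth
   complete toric variety. *)
Definition is_intersection_degree (d n : nat) (v : 'I_n -> 'rV[int]_d)
  (F : {set {set 'I_n}}) (deg : {ffun 'I_n -> nat} -> int) : Prop :=
  (forall e : {ffun 'I_n -> nat}, (\sum_i e i)%N = d ->
      [set i | (0 < e i)%N] \notin F -> deg e = 0) /\
  (forall s : {set 'I_n}, s \in F -> #|s| = d -> deg (indic_exp s) = 1) /\
  (forall (m : 'cV[int]_d) (e : {ffun 'I_n -> nat}), (\sum_i e i).+1 = d ->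
      \sum_i (v i *m m) 0 0 * deg (incr_exp e i) = 0).

(* (ch_k(X) . V(t)) = (1/k!) sum_i (D_i^k . prod_(j in t) D_j) *)
Definition ch_dot (n : nat) (deg : {ffun 'I_n -> nat} -> int) (k : nat)
  (t : {set 'I_n}) : rat :=
  (k`!%:R)^-1 * \sum_(i : 'I_n)
     (deg [ffun j => ((j == i) * k + nat_of_bool (j \in t))%N])%:~R.

(* ch_k(X) is positive: positive on every k-dimensional torus-invariant
   irreducible closed subvariety, i.e. on V(t) for every cone t of
   dimension d - k. *)
Definition ch_positive (d n : nat) (F : {set {set 'I_n}})
  (deg : {ffun 'I_n -> nat} -> int) (k : nat) : Prop :=
  forall t : {set 'I_n}, t \in F -> (#|t| + k)%N = d -> 0 < ch_dot deg k t.

(* Main.v *)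
Require Import Defs.
From HB Require Import structures.
From mathcomp Require Import all_boot all_order all_algebra.
From mathcomp Require Import zify ring.
Import Order.TTheory GRing.Theory Num.Theory.
Local Open Scope ring_scope.
Set Implicit Arguments. Unset Strict Implicit.

(** For [n = d + 2] a maximal cone omits exactly two rays; join two rays by an
    edge when the remaining ones span a cone. The linear relations among the
    intersection numbers [D_i . C], for [C] the curve of a wall, show that of
    three rays exactly zero or two pairs are edges, so that the graph is
    complete bipartite with parts [X] and [Y]. The same relations give that, up
    to exchanging [X] and [Y], the divisors [D_x] share a class [H] and
    [D_y = xi + a_y H] (Kleinschmidt). If [Y] has at least four elements, take
    the fourfold [V(t)] fibred over [P^1] by the four largest [a_k]; then
    [D_y^4 . V(t) = sum_k (a_y - a_k)] and [D_x^4 . V(t) = 0]. Otherwise [X] has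
    at least four elements; take the fourfold fibred over [P^3] by the two
    largest [a_k, a_l], where [D_y^4 . V(t) = (p + q)(p^2 + q^2)] with
    [p = a_y - a_k] and [q = a_y - a_l]. In both cases the terms of the chosen
    [y] cancel and all the others are nonpositive. *)

(** * Linear relations among the rays *)

Lemma Z_basis_free d n (v : 'I_n -> 'rV[int]_d) (s : {set 'I_n}) (c : 'I_n -> int) :
  Z_basis v s -> \sum_(i in s) c i *: v i = 0 -> forall i, i \in s -> c i = 0.
Proof.
case=> sd; subst d => span c0 i si.
pose A : 'M_#|s| := \matrix_j v (enum_val j).
have AE (b : 'I_n -> int) :
    \sum_(i in s) b i *: v i = (\row_j b (enum_val j)) *m A.
  rewrite big_enum_val mulmx_sum_row; apply: eq_bigr => j _.
  by rewrite rowK mxE.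
(* Spanning gives a left inverse of the square matrix [A]; over a commutative ring it is also a
   right inverse, whence independence. *)
have [C CA] : exists C : 'M_#|s|, C *m A = 1%:M.
  have /fin_all_exists [b bE] (j : 'I_#|s|) :
      exists b : 'I_n -> int, delta_mx 0 j = \sum_(i in s) b i *: v i.
    exact: span.
  exists (\matrix_j \row_l b j (enum_val l)); apply/row_matrixP => j.
  by rewrite row_mul rowK -AE -bE row1.
have : \row_j c (enum_val (A := mem s) j) = 0.
  by rewrite -[\row_j _]mulmx1 -(mulmx1C CA) mulmxA -AE c0 mul0mx.
move/rowP/(_ (enum_rank_in si i)); rewrite !mxE enum_rankK_in //.
Qed.

Definition relation d n (v : 'I_n -> 'rV[int]_d) (f : 'I_n -> int) : Prop :=
  \sum_i f i *: v i = 0.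

Lemma relation_comb d n (v : 'I_n -> 'rV[int]_d) (f g h : 'I_n -> int) (x y : int) :
  relation v f -> relation v g -> relation v h ->
  relation v (fun i => f i - x * g i - y * h i).
Proof.
rewrite /relation => Rf Rg Rh.
under eq_bigr do rewrite !scalerBl -!scalerA.
by rewrite !sumrB -!scaler_sumr Rf Rg Rh !scaler0 !subr0.
Qed.

(** Once the coefficients at [i] and [j] vanish, only a basis is involved. So the values at an edge
    are coordinates on the module of relations. *)
Lemma relation_eq0 d n (v : 'I_n -> 'rV[int]_d) (f : 'I_n -> int) (i j : 'I_n) :
  Z_basis v (~: [set i; j]) -> relation v f -> f i = 0 -> f j = 0 ->
  forall k, f k = 0.
Proof.
move=> B R fi fj k.
have [/set2P[->|->] //|kij] := boolP (k \in [set i; j]).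
apply: (Z_basis_free B); last by rewrite inE.
rewrite -[RHS]R [in RHS](bigID (mem (~: [set i; j]))) /=.
rewrite [X in _ = _ + X]big1 ?addr0 // => l.
by rewrite inE negbK => /set2P[->|->]; rewrite (fi, fj) scale0r.
Qed.

Lemma relation_ext d n (v : 'I_n -> 'rV[int]_d) (f g h : 'I_n -> int) (i j : 'I_n) :
  Z_basis v (~: [set i; j]) -> relation v f -> relation v g -> relation v h ->
  g i = 1 -> g j = 0 -> h i = 0 -> h j = 1 ->
  forall k, f k = f i * g k + f j * h k.
Proof.
move=> B Rf Rg Rh gi gj hi hj k.
have := relation_eq0 B (relation_comb (f i) (f j) Rf Rg Rh).
rewrite gi gj hi hj !(mulr1, mulr0, subr0, subrr) => /(_ erefl erefl k); lia.
Qed.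

Lemma relation_exists d n (v : 'I_n -> 'rV[int]_d) (i j : 'I_n) :
  i != j -> Z_basis v (~: [set i; j]) ->
  exists f, [/\ relation v f, f i = 1 & f j = 0].
Proof.
move=> ij [_ /(_ (v i)) [c ci]].
exists (fun k => if k == i then 1 else if k == j then 0 else - c k).
rewrite eqxx eq_sym (negbTE ij) eqxx; split=> //.
rewrite /relation (bigID (mem (~: [set i; j]))) /= [X in _ + X](bigD1 i) /=; last first.
  by rewrite !inE eqxx.
rewrite [X in _ + (_ + X)]big1 ?addr0; last first.
  move=> k; rewrite !inE negbK => /andP[/orP[/eqP->|/eqP->]]; first by rewrite eqxx.
  by move=> /negbTE->; rewrite eqxx scale0r.
rewrite eqxx scale1r ci -big_split big1 //= => k.
by rewrite !inE negb_or => /andP[/negbTE-> /negbTE->]; rewrite scaleNr addNr.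
Qed.

Lemma deg_relation d n (v : 'I_n -> 'rV[int]_d) F deg (e : {ffun 'I_n -> nat}) :
  is_intersection_degree v F deg -> (\sum_i e i).+1 = d ->
  relation v (fun i => deg (incr_exp e i)).
Proof.
case=> _ [_ lin] ed; apply/rowP => j; rewrite summxE mxE.
rewrite -[RHS](lin (delta_mx j 0) e ed); apply: eq_bigr => i _.
by rewrite -colE !mxE mulrC.
Qed.

Lemma sum_indic n (s : {set 'I_n}) : (\sum_i indic_exp s i)%N = #|s|.
Proof. by under eq_bigr do rewrite ffunE; rewrite -big_mkcond sum1_card. Qed.

Lemma deg_indic d n (v : 'I_n -> 'rV[int]_d) F deg (s : {set 'I_n}) :
  is_intersection_degree v F deg -> #|s| = d -> deg (indic_exp s) = (s \in F)%:R.
Proof.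
case=> deg0 [deg1 _] sd; have [sF|sF] := boolP (s \in F); first exact: deg1.
apply: deg0; first by rewrite sum_indic.
rewrite (_ : [set i | _] = s) //.
by apply/setP => i; rewrite inE ffunE; case: (i \in s).
Qed.

(** * The bipartite graph of maximal cones *)

Section Bipartition.
Variables (d n : nat) (v : 'I_n -> 'rV[int]_d) (F : {set {set 'I_n}}).
Variable deg : {ffun 'I_n -> nat} -> int.
Hypothesis fan : smooth_complete_fan v F.
Hypothesis nd : n = d.+2.
Hypothesis degP : is_intersection_degree v F deg.

Let adj (i j : 'I_n) := ~: [set i; j] \in F.

Let adjC i j : adj i j = adj j i. Proof. by rewrite /adj setUC. Qed.

Let cardC (s : {set 'I_n}) : #|~: s| = (d.+2 - #|s|)%N.
Proof. by rewrite cardsCs setCK card_ord -nd. Qed.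

Let card_in s : s \in F -> (#|s| <= d)%N.
Proof.
by case: fan => _ [_ [mx _]] /mx[t _ [/subset_leq_card st [td _]]]; rewrite td in st.
Qed.

Let adjii i : adj i i = false.
Proof.
by apply/negP => /card_in; rewrite cardC setUid cards1 subn1 ltnn.
Qed.

Let adj_neq i j : adj i j -> i != j.
Proof. by case: eqP => // ->; rewrite adjii. Qed.

Let adj_basis i j : adj i j -> Z_basis v (~: [set i; j]).
Proof.
move=> ij; case: fan => _ [_ [mx _]]; have [t _ [st B]] := mx _ ij.
suff -> : ~: [set i; j] = t by [].
apply/eqP; rewrite eqEcard st /=; case: (B) => td _; rewrite td.
by rewrite cardC cards2 adj_neq // subn2.
Qed.

(** Take [f l] to be the degree of [D_l] times the divisors of all rays but [i], [j], [k]. For [l]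
    one of these three, the monomial is square-free and omits just the other two. *)
Let wall_relation i j k : i != j -> i != k -> j != k ->
  exists f, [/\ relation v f, f i = (adj j k)%:R, f j = (adj i k)%:R
    & f k = (adj i j)%:R].
Proof.
move=> ij ik jk; pose w := ~: [set i; j; k].
have cw : (#|w|).+1 = d.
  have : (#|[set i; j; k]| <= n)%N by rewrite -[leqRHS]card_ord max_card.
  rewrite /w cardC setUC cardsU1 cards2 !inE ij negb_or (eq_sym k i) ik.
  rewrite (eq_sym k j) jk /=; lia.
have fE l a b : a != b ->
    (forall z, (z \in [set i; j; k]) = [|| z == l, z == a | z == b]) ->
    l != a -> l != b -> deg (incr_exp (indic_exp w) l) = (adj a b)%:R.
  move=> ab wl la lb; rewrite -(deg_indic degP) /adj; last first.
    by rewrite cardC cards2 ab subn2.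
  congr deg; apply/ffunP => z; rewrite !ffunE inE wl !inE.
  by case: eqVneq => [->|_] /=; rewrite ?(negbTE la) ?(negbTE lb) ?addn0.
exists (fun l => deg (incr_exp (indic_exp w) l)); split.
- by apply: (deg_relation degP); rewrite sum_indic.
- by apply: fE => // z; rewrite !inE orbA.
- by apply: fE; rewrite // 1?eq_sym // => z; rewrite !inE -orbA orbCA.
- by apply: fE; rewrite // 1?eq_sym // => z; rewrite !inE orbC.
Qed.

(** With [h] the relation that is [1] at [k] and [0] at [j], the edge [j], [k] gives [g = g k * h];
    at [i] this reads [1 = g k * h i], so [g k] is a unit. *)
Let relation_unit i j k g : adj i j -> adj j k ->
  relation v g -> g i = 1 -> g j = 0 -> g k = 1 \/ g k = -1.
Proof.
move=> ij jk Rg gi gj; have kj : adj k j by rewrite adjC.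
have [h [Rh hk hj]] := relation_exists (adj_neq kj) (adj_basis kj).
have := relation_eq0 (adj_basis kj) (relation_comb (g k) 0 Rg Rh Rh).
rewrite gj hk hj !(mul0r, mulr0, mulr1, subr0, subrr) => /(_ erefl erefl i).
rewrite gi mul0r subr0 => /eqP; rewrite subr_eq0 => /eqP/(congr1 absz).
by rewrite abszM => /esym/eqP; rewrite muln_eq1 => /andP[/eqP gk _]; lia.
Qed.

(* Modulo the span of the wall the three rays would be generators of Z whose
   sum vanishes, which parity forbids. *)
Let no_triangle i j k : adj i j -> adj i k -> adj j k -> False.
Proof.
move=> ij ik jk; have [f [Rf]] := wall_relation (adj_neq ij) (adj_neq ik) (adj_neq jk).
rewrite ij ik jk /= => fi fj fk; have ji : adj j i by rewrite adjC.
have [g [Rg gi gj]] := relation_exists (adj_neq ij) (adj_basis ij).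
have [h [Rh hj hi]] := relation_exists (adj_neq ji) (adj_basis ji).
have := relation_ext (adj_basis ij) Rf Rg Rh gi gj hi hj k.
have := relation_unit ij jk Rg gi gj; have := relation_unit ji ik Rh hj hi.
rewrite fi fj fk; lia.
Qed.

(** For a third ray [k], two edges would close a triangle; none would give a wall relation vanishing
    at the edge [i], [j] but equal to [1] at [k]. *)
Let adj_addb i j k : adj i j -> adj i k (+) adj j k.
Proof.
move=> ij; have [->|ki] := eqVneq k i; first by rewrite adjii adjC ij.
have [->|kj] := eqVneq k j; first by rewrite adjii ij.
have [ik|ik] := boolP (adj i k); have [jk|jk] := boolP (adj j k) => //.
  by case: (no_triangle ij ik jk).
move: ki kj; rewrite 2!(eq_sym k) => ki kj.
have [f [Rf]] := wall_relation (adj_neq ij) ki kj.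
rewrite ij (negbTE ik) (negbTE jk) /= => fi fj fk.
by have := relation_eq0 (adj_basis ij) Rf fi fj k; rewrite fk.
Qed.

(** The parts are the neighbours of [i0] and the rest. If just one of [i], [j] is joined to [i0],
    then [adj_addb] at that edge makes [i], [j] an edge. *)
Let adjE i0 i j : adj i j = adj i i0 (+) adj j i0.
Proof.
have [ij|] := boolP (adj i j); first by rewrite (adj_addb i0 ij).
have := @adj_addb i i0 j; have := @adj_addb j i0 i; rewrite !(adjC i0) (adjC j i).
by case: (adj i j); case: (adj i i0); case: (adj j i0) => //= [_ -> |-> ].
Qed.

(* The normal form of Kleinschmidt: up to exchanging the two primitive
   collections, all divisors in [X] share the class [H] and those outside
   differ by multiples [a i * H]. *)
Lemma divisor_classes : exists (X : {set 'I_n}) (a : 'I_n -> int),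
  [/\ (1 < #|X|)%N, (1 < #|~: X|)%N,
      forall s, (s \in F) = ~~ (X \subset s) && ~~ (~: X \subset s),
      forall f, relation v f -> {in X &, forall x x', f x = f x'}
    & forall f, relation v f ->
        forall x y y', x \in X -> y \notin X -> y' \notin X ->
        f y = f y' + (a y - a y') * f x].
Proof.
have [x0 [y0 xy0]] : exists x0 y0, adj x0 y0.
  have i0 : 'I_n by rewrite nd; exact: ord0.
  case: fan => _ [sg [mx _]]; have [t tF [_ [td _]]] := mx _ (sg i0).
  have : #|~: t| == 2%N by rewrite cardC td subSn // subSnn.
  by case/cards2P => x [y [_ E]]; exists x, y; rewrite /adj -E setCK.
pose X := [set i | adj i y0].
have XE i j : adj i j = (i \in X) (+) (j \in X) by rewrite !inE; exact: adjE.
(* Cones are the subsets of complements of edges, and an edge picks one ray from each part. *)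
have FE s : (s \in F) = ~~ (X \subset s) && ~~ (~: X \subset s).
  case: fan => dn [_ [mx _]]; apply/idP/andP => [sF|[/subsetPn[x xX xs] /subsetPn[y]]].
    have [t tF [st [td _]]] := mx _ sF.
    have : #|~: t| == 2%N by rewrite cardC td subSn // subSnn.
    case/cards2P => x [y [_ E]].
    have ns z : z \in ~: t -> z \notin s by rewrite inE; apply/contra/subsetP.
    have xs : x \notin s by apply: ns; rewrite E !inE eqxx.
    have ys : y \notin s by apply: ns; rewrite E !inE eqxx orbT.
    have : adj x y by rewrite /adj -E setCK.
    rewrite XE; case: (boolP (x \in X)); case: (boolP (y \in X)) => //= yX xX _.
      by split; apply/subsetPn; first exists x => //; exists y; rewrite ?in_setC.
    by split; apply/subsetPn; first exists y => //; exists x; rewrite ?in_setC.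
  rewrite in_setC => yX ys; apply: (dn (~: [set x; y])).
    by rewrite -/(adj x y) XE xX (negbTE yX).
  apply/subsetP => z zs; rewrite !inE; apply/norP.
  by split; apply/eqP => zE; rewrite -zE zs in xs ys.
have card2 (Z : {set 'I_n}) : (forall s, s \in F -> ~~ (Z \subset s)) -> (1 < #|Z|)%N.
  move=> ZF; case: fan => _ [sg _].
  have [x xZ _] := subsetPn (ZF _ (sg x0)); have [y yZ] := subsetPn (ZF _ (sg x)).
  by rewrite inE => yx; apply/card_gt1P; exists x, y; rewrite 1?eq_sym.
have X2 : (1 < #|X|)%N by apply: card2 => s; rewrite FE => /andP[].
have Y2 : (1 < #|~: X|)%N by apply: card2 => s; rewrite FE => /andP[].
have yx0 : adj y0 x0 by rewrite adjC.
(* [a] and [b] form the basis of the relations dual to the values at [x0] and [y0]. *)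
have [a [Ra ax ay]] := relation_exists (adj_neq xy0) (adj_basis xy0).
have [b [Rb bY bx]] := relation_exists (adj_neq yx0) (adj_basis yx0).
have ext f : relation v f -> forall k, f k = f x0 * a k + f y0 * b k.
  by move=> Rf; apply: relation_ext (adj_basis xy0) Rf Ra Rb ax ay bx bY.
have x0X : x0 \in X by rewrite inE.
have y0X : y0 \notin X by rewrite inE adjii.
(* The wall relation of [x0], [x], [y0] is [1] at [x0] and [x] and [0] at [y0], so it is [a]
   itself. *)
have aX x : x \in X -> a x = 1.
  move=> xX; have [-> //|xx0] := eqVneq x x0.
  have [|||f [Rf]] := @wall_relation x0 x y0; first by rewrite eq_sym.
  - exact: adj_neq.
  - by apply: adj_neq; rewrite XE xX (negbTE y0X).
  rewrite !XE x0X xX (negbTE y0X) /=.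
  by move=> f0 fx fy; move: (ext f Rf x); rewrite f0 fx fy; lia.
have bYX y : y \notin X -> b y = 1.
  move=> yX; have [-> //|yy0] := eqVneq y y0.
  have [|||f [Rf]] := @wall_relation x0 y y0 => //.
  - by apply: adj_neq; rewrite XE x0X (negbTE yX).
  - exact: adj_neq.
  rewrite !XE x0X (negbTE yX) (negbTE y0X) /=.
  by move=> f0 fx fy; move: (ext f Rf y); rewrite f0 fx fy; lia.
(* The wall relation of [x0], [x], [y] is [1] at [x0] and [x] and [0] at [y]; written in [a] and
   [b], this yields [a y * b x = 0]. *)
have ba x y : x \in X -> y \notin X -> b x = 0 \/ a y = 0.
  move=> xX yX; have [->|xx0] := eqVneq x x0; first by left.
  have [|||f [Rf]] := @wall_relation x0 x y; first by rewrite eq_sym.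
  - by apply: adj_neq; rewrite XE x0X (negbTE yX).
  - by apply: adj_neq; rewrite XE xX (negbTE yX).
  rewrite !XE x0X xX (negbTE yX) /=.
  move=> f0 fx fy; move: (ext f Rf x) (ext f Rf y).
  rewrite f0 fx fy (aX x xX) (bYX y yX) => H1 H2.
  have : f y0 * b x = 0 by lia.
  by move/eqP; rewrite mulf_eq0 => /orP[/eqP fy0|/eqP]; [right; lia|left].
have [/forall_inP b0|] := boolP [forall x in X, b x == 0].
  exists X, a; split=> // f Rf.
    move=> x x' xX xX'.
    by rewrite (ext f Rf x) (ext f Rf x') !aX // (eqP (b0 _ _)) ?(eqP (b0 _ _)).
  move=> x y y' xX yX yX'; rewrite (ext f Rf x) (ext f Rf y) (ext f Rf y').
  by rewrite (aX x) // (eqP (b0 x xX)) !bYX //; ring.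
rewrite negb_forall => /existsP[x]; rewrite negb_imply => /andP[xX /eqP bx0].
(* One nonzero [b x] forces [a] to vanish off [X]; the two parts then exchange roles, with [b] in
   place of [a]. *)
have a0 y : y \notin X -> a y = 0 by case/(ba x y xX).
exists (~: X), b; split; rewrite ?setCK //.
- by move=> s; rewrite FE andbC.
- move=> f Rf x' y'; rewrite !in_setC => xX' yX'.
  by rewrite (ext f Rf x') (ext f Rf y') !a0 // !bYX // !mulr0.
move=> f Rf y x1 x2; rewrite !in_setC !negbK => yX xX1 xX2.
rewrite (ext f Rf x1) (ext f Rf x2) (ext f Rf y) (a0 y) // (bYX y) // !aX //; ring.
Qed.

End Bipartition.

(** * Monomials and the choice of the largest [a k] *)

(* Exponent vector of [V(s)] times the divisors listed in [l]. *)
Definition monomial n (s : {set 'I_n}) (l : seq 'I_n) : {ffun 'I_n -> nat} :=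
  [ffun j => ((j \in s) + count_mem j l)%N].

Lemma monomial_cons n (s : {set 'I_n}) i l :
  monomial s (i :: l) = incr_exp (monomial s l) i.
Proof. by apply/ffunP => j; rewrite !ffunE /= eq_sym addnA addnAC. Qed.

Lemma perm_monomial n (s : {set 'I_n}) l1 l2 :
  perm_eq l1 l2 -> monomial s l1 = monomial s l2.
Proof. by move/permP => l12; apply/ffunP => j; rewrite !ffunE l12. Qed.

Lemma sum_monomial n (s : {set 'I_n}) l :
  (\sum_i monomial s l i = #|s| + size l)%N.
Proof.
elim: l => [|i l IHl].
  rewrite addn0 -sum_indic; apply: eq_bigr => i _.
  by rewrite !ffunE addn0.
rewrite monomial_cons; under eq_bigr do rewrite ffunE.
rewrite big_split /= IHl -addnA -addn1; congr (_ + (_ + _))%N.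
by rewrite (bigD1 i) //= eqxx big1 // => j /negbTE->.
Qed.

Lemma support_monomial n (s : {set 'I_n}) l :
  [set j | (0 < monomial s l j)%N] = s :|: [set j in l].
Proof.
by apply/setP => j; rewrite !inE ffunE addn_gt0 -has_count has_pred1; case: (j \in s).
Qed.

Lemma monomial_uniq n (s : {set 'I_n}) l :
  uniq l -> {in l, forall j, j \notin s} ->
  monomial s l = indic_exp (s :|: [set j in l]).
Proof.
move=> ul ls; apply/ffunP => j; rewrite !ffunE !inE count_uniq_mem //.
by case: (boolP (j \in l)) => [/ls/negbTE->|]; rewrite ?orbT ?orbF ?addn0.
Qed.

Lemma ch_dotE n deg k (t : {set 'I_n}) :
  ch_dot deg k t =
  (k`!%:R)^-1 * (\sum_i deg (monomial t (nseq k i)))%:~R.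
Proof.
rewrite /ch_dot rmorph_sum; congr (_ * _); apply: eq_bigr => i _.
congr (_%:~R); congr deg; apply/ffunP => j.
by rewrite !ffunE count_nseq /= addnC eq_sym mulnC mulnC.
Qed.

Lemma exists_largest n (Y : {set 'I_n}) (a : 'I_n -> int) m :
  (m <= #|Y|)%N ->
  exists q : seq 'I_n, [/\ uniq q, size q = m, {subset q <= Y}
    & forall y, y \in Y -> y \notin q -> forall k, k \in q -> a y <= a k].
Proof.
elim: m => [|m IHm] mY; first by exists [::].
have [q [uq sq qY qmax]] := IHm (ltnW mY).
have [y0 y0Y y0q] : exists2 y, y \in Y & y \notin q.
  apply/subsetPn; apply: contraL mY => /subset_leq_card Yq.
  by rewrite -leqNgt -sq (leq_trans Yq) // card_size.
pose P := [pred y | (y \in Y) && (y \notin q)].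
have y0P : P y0 by apply/andP.
case: (arg_maxP (P := P) a y0P) => /= y /andP[yY yq] ymax.
exists (y :: q); split; rewrite /= ?yq ?sq //.
- by move=> z /predU1P[->|/qY].
move=> z zY; rewrite inE negb_or => /andP[zy zq] k /predU1P[->|kq].
  by apply: ymax; rewrite zY.
exact: qmax.
Qed.

Lemma sum_le0 n (Y : {set 'I_n}) (q : seq 'I_n) (f : 'I_n -> int) :
  uniq q -> {subset q <= Y} -> \sum_(y <- q) f y = 0 ->
  (forall y, y \in Y -> y \notin q -> f y <= 0) -> \sum_(y in Y) f y <= 0.
Proof.
move=> uq qY fq fle; rewrite (bigID (mem q)) /= (eq_bigl (mem q)); last first.
  by move=> y; rewrite andb_idl //; exact: qY.
rewrite -big_uniq // fq add0r; apply: sumr_le0 => y /andP[yY yq].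
exact: fle.
Qed.

(** * Quartic intersection numbers on [V(t)] *)

Section Quartics.
Variables (d n : nat) (v : 'I_n -> 'rV[int]_d) (F : {set {set 'I_n}}).
Variables (deg : {ffun 'I_n -> nat} -> int) (X : {set 'I_n}) (a : 'I_n -> int).
Hypothesis nd : n = d.+2.
Hypothesis degP : is_intersection_degree v F deg.
Hypothesis FE : forall s, (s \in F) = ~~ (X \subset s) && ~~ (~: X \subset s).
Hypothesis relX : forall f, relation v f -> {in X &, forall x x', f x = f x'}.
Hypothesis relY : forall f, relation v f ->
  forall x y y', x \in X -> y \notin X -> y' \notin X ->
  f y = f y' + (a y - a y') * f x.

(* The rays outside the cone [t] of the fourfold [V(t)]. *)
Variable q : seq 'I_n.
Hypotheses (uq : uniq q) (q6 : size q = 6%N).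

Let t := ~: [set z in q].
Let D (i j k l : 'I_n) := deg (monomial t [:: i; j; k; l]).

Lemma card_cone : (#|t| + 4 = d)%N.
Proof.
have : (#|[set z in q]| <= n)%N by rewrite -[leqRHS]card_ord max_card.
rewrite [#|t|]cardsCs setCK card_ord cardsE (card_uniqP uq) q6 nd; lia.
Qed.

Lemma coneF x y : x \in X -> x \in q -> y \notin X -> y \in q -> t \in F.
Proof.
move=> xX xq yX yq; rewrite FE; apply/andP; split; apply/subsetPn.
  by exists x; rewrite // !inE xq.
by exists y; rewrite !inE ?yX ?yq.
Qed.

(** The relations are applied at the first index; [deg_rot] and [deg_swap] bring the others
    there. *)
Lemma deg_rot i j k l : D i j k l = D j k l i.
Proof.
congr deg; apply: perm_monomial.
by rewrite -[[:: j; k; l; i]]/([:: j; k; l] ++ [:: i]) perm_sym perm_catC.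
Qed.

Lemma deg_swap i j k l : D i j k l = D j i k l.
Proof.
congr deg; apply: perm_monomial.
exact/permPl/(perm_catCA [:: i] [:: j] [:: k; l]).
Qed.

Let relD j k l : relation v (fun i => D i j k l).
Proof.
have := deg_relation degP (e := monomial t [:: j; k; l]).
rewrite sum_monomial -addnS card_cone => /(_ erefl).
by rewrite /relation /D; under [in X in _ -> X]eq_bigr do rewrite monomial_cons.
Qed.

Lemma degX x x' j k l : x \in X -> x' \in X -> D x j k l = D x' j k l.
Proof. exact: (relX (relD j k l)). Qed.

Lemma degY x y y' j k l : x \in X -> y \notin X -> y' \notin X ->
  D y j k l = D y' j k l + (a y - a y') * D x j k l.
Proof. exact: (relY (relD j k l)). Qed.

(** [t] already contains the rays of [X] outside [q], so listing the remaining ones puts all of [X]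
    into the support, which is then no cone. *)
Lemma degX_eq0 i j k l :
  all (fun z => (z \in X) ==> (z \in [:: i; j; k; l])) q -> D i j k l = 0.
Proof.
move=> /allP H; case: degP => deg0 _; apply: deg0; first by rewrite sum_monomial card_cone.
rewrite support_monomial FE negb_and negbK; apply/orP; left.
apply/subsetP => z zX; rewrite in_setU in_setC !in_set.
by case: (boolP (z \in q)) => // /H/implyP->.
Qed.

Lemma degY_eq0 i j k l :
  all (fun z => (z \notin X) ==> (z \in [:: i; j; k; l])) q -> D i j k l = 0.
Proof.
move=> /allP H; case: degP => deg0 _; apply: deg0; first by rewrite sum_monomial card_cone.
rewrite support_monomial FE negb_and !negbK; apply/orP; right.
apply/subsetP => z; rewrite in_setC => zX.
by rewrite in_setU in_setC !in_set; case: (boolP (z \in q)) => // /H/implyP->.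
Qed.

(** The monomial is square-free and its support is the complement of [x] and [y], a maximal cone. *)
Lemma deg_eq1 x y i j k l : perm_eq [:: x; y; i; j; k; l] q ->
  x \in X -> y \notin X -> D i j k l = 1.
Proof.
move=> pq xX yX; have u : uniq [:: x; y; i; j; k; l] by rewrite (perm_uniq pq).
have sub : {subset [:: x; y; i; j; k; l] <= q} by move=> z; rewrite (perm_mem pq).
pose s := [:: i; j; k; l].
have us : uniq s by move: u => /= /and3P[].
have sq z : z \in s -> z \in q.
  by move=> zs; apply: sub; rewrite 2!in_cons zs !orbT.
have ns z : z \in q -> z \notin s -> z \notin t :|: [set j in s].
  by move=> zq zs; rewrite in_setU in_setC !in_set zq.
case: degP => _ [deg1 _]; rewrite /D monomial_uniq //; last first.
  by move=> z /sq zq; rewrite in_setC in_set negbK.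
apply: deg1; last first.
  rewrite -sum_indic -monomial_uniq ?sum_monomial ?card_cone // => z /sq zq.
  by rewrite in_setC in_set negbK.
rewrite FE; move: u; rewrite [uniq _]/= 1!in_cons negb_or.
move=> /andP[/andP[_ xs] /andP[ys _]].
apply/andP; split; apply/subsetPn.
  by exists x; rewrite ?ns // sub // mem_head.
by exists y; rewrite ?in_setC ?ns // sub // !inE eqxx orbT.
Qed.


(** Only two rays of [X] lie outside [t], so [H^2 = 0] on [V(t)], while [H] times three of the [D_y]
    is [1]. Replacing the factors of [D_i^4] by [D_k1], ..., [D_k4] one at a time contributes
    [a i - a k] each, and the final product is [0]. *)
Lemma quartic_linear k1 k2 k3 k4 x1 x2 : q = [:: k1; k2; k3; k4; x1; x2] ->
  all (fun k => k \notin X) [:: k1; k2; k3; k4] -> x1 \in X -> x2 \in X ->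
  forall i, D i i i i =
    if i \in X then 0 else \sum_(k <- [:: k1; k2; k3; k4]) (a i - a k).
Proof.
move=> qE /and5P[k1X k2X k3X k4X _] x1X x2X i.
have k1F := negbTE k1X; have k2F := negbTE k2X.
have k3F := negbTE k3X; have k4F := negbTE k4X.
have XX x x' j k : x \in X -> x' \in X -> D x x' j k = 0.
  move=> xX x'X; rewrite (degX _ _ _ xX x1X) deg_swap (degX _ _ _ x'X x2X).
  apply: degX_eq0.
  by rewrite qE /= k1F k2F k3F k4F x1X x2X !inE !eqxx !orbT.
case: ifPn => iX; first exact: XX.
have X_X x x' j k : x \in X -> x' \in X -> D x j x' k = 0.
  by move=> xX x'X; rewrite deg_swap deg_rot XX.
have X__X x x' j k : x \in X -> x' \in X -> D x j k x' = 0.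
  by move=> xX x'X; rewrite -deg_rot XX.
(* As [H^2 = 0], the other factors may be changed to [D_k1], [D_k2], [D_k3], giving a square-free
   monomial. *)
have x1Y j k l : j \notin X -> k \notin X -> l \notin X -> D x1 j k l = 1.
  move=> jX kX lX.
  rewrite deg_rot (degY _ _ _ x1X jX k1X) (X__X x1) // mulr0 addr0.
  rewrite deg_rot (degY _ _ _ x1X kX k2X) (X_X x1) // mulr0 addr0.
  rewrite deg_rot (degY _ _ _ x1X lX k3X) (XX x1) // mulr0 addr0.
  apply: (deg_eq1 (x := x2) (y := k4)) => //.
  by rewrite qE; apply/permP => P /=; ring.
rewrite !big_cons big_nil.
rewrite (degY _ _ _ x1X iX k1X) x1Y // deg_rot.
rewrite (degY _ _ _ x1X iX k2X) x1Y // deg_rot.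
rewrite (degY _ _ _ x1X iX k3X) x1Y // deg_rot.
rewrite (degY _ _ _ x1X iX k4X) x1Y // degY_eq0; last first.
  by rewrite qE /= k1F k2F k3F k4F x1X x2X !inE !eqxx !orbT.
by ring.
Qed.

(** Here [H^4 = 0] and [H^3 D_i = 1]. With [p = a i - a k] and [r = a i - a l], a quadratic relation
    for [D_i] yields in turn the complete symmetric polynomials [H^2 D_i^2 = p + r],
    [H D_i^3 = p^2 + p r + r^2] and finally [D_i^4]. *)
Lemma quartic_cubic k l x1 x2 x3 x4 : q = [:: k; l; x1; x2; x3; x4] ->
  k \notin X -> l \notin X -> all (fun x => x \in X) [:: x1; x2; x3; x4] ->
  forall i, D i i i i =
    if i \in X then 0
    else ((a i - a k) + (a i - a l)) * ((a i - a k) ^+ 2 + (a i - a l) ^+ 2).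
Proof.
move=> qE kX lX /and5P[x1X x2X x3X x4X _] i.
have kF := negbTE kX; have lF := negbTE lX.
have XXXX x y z w : x \in X -> y \in X -> z \in X -> w \in X -> D x y z w = 0.
  move=> xX yX zX wX.
  rewrite (degX _ _ _ xX x1X) deg_rot (degX _ _ _ yX x2X) deg_rot.
  rewrite (degX _ _ _ zX x3X) deg_rot (degX _ _ _ wX x4X).
  by apply: degX_eq0; rewrite qE /= kF lF x1X x2X x3X x4X !inE !eqxx !orbT.
case: ifPn => iX; first exact: XXXX.
(* [(D_i - (a_i - a_k) H) (D_i - (a_i - a_l) H) = D_k D_l] vanishes on [V(t)]. *)
have rec u w : D i i u w = ((a i - a k) + (a i - a l)) * D x1 i u w
                          - (a i - a k) * (a i - a l) * D x1 x1 u w.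
  have Dkl : D k l u w = 0.
    by apply: degY_eq0; rewrite qE /= kF lF x1X x2X x3X x4X !inE !eqxx !orbT.
  have := degY i u w x1X iX kX; have := degY k u w x1X iX lX.
  have := degY x1 u w x1X iX kX.
  rewrite [D i k _ _]deg_swap [D l k _ _]deg_swap Dkl.
  rewrite [D i x1 _ _]deg_swap [D k x1 _ _]deg_swap.
  by move=> -> -> ->; ring.
(* [H^4 = 0] lets [D_k] replace [D_i]; spreading [H^3] over [x1], [x2], [x3] makes the monomial
   square-free. *)
have D1 : D x1 x1 x1 i = 1.
  rewrite -deg_rot (degY _ _ _ x1X iX kX) (XXXX x1) // mulr0 addr0.
  rewrite deg_rot (degX _ _ _ x1X x2X) deg_rot (degX _ _ _ x1X x3X) deg_rot.
  apply: (deg_eq1 (x := x4) (y := l)) => //.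
  by rewrite qE; apply/permP => P /=; ring.
have D2 : D x1 x1 i i = (a i - a k) + (a i - a l).
  by rewrite 2!deg_rot rec deg_swap deg_rot D1 XXXX //; ring.
have D3 : D x1 i i i = ((a i - a k) + (a i - a l)) ^+ 2 - (a i - a k) * (a i - a l).
  by rewrite deg_rot rec -[D x1 i i x1]deg_rot D2 -[D x1 x1 i x1]deg_rot D1; ring.
by rewrite rec D2 D3; ring.
Qed.

End Quartics.

(** * Contradiction with positivity *)

Theorem theorem4p4 (d n : nat) (v : 'I_n -> 'rV[int]_d)
  (F : {set {set 'I_n}}) (deg : {ffun 'I_n -> nat} -> int) :
  (5 <= d)%N ->
  smooth_complete_fan v F ->
  picard_number d n = 2%N ->
  is_intersection_degree v F deg ->
  ~ ch_positive d F deg 4.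
Proof.
move=> d5 fan pic degP pos.
have nd : n = d.+2 by move: pic; rewrite /picard_number; lia.
have [X [a [X2 Y2 FE relX relY]]] := divisor_classes fan nd degP.
have cXY : (#|X| + #|~: X| = d.+2)%N by rewrite cardsC card_ord.
pose D (q : seq 'I_n) i := deg (monomial (~: [set z in q]) [:: i; i; i; i]).
(* Positivity on the fourfold whose cone omits [q], with the factor [1/4!] dropped and the vanishing
   terms of [X] removed. *)
have key (q x y : seq 'I_n) (f : 'I_n -> int) :
    q = y ++ x -> uniq x -> uniq y -> size q = 6%N ->
    {subset x <= X} -> {subset y <= ~: X} -> x != [::] -> y != [::] ->
    (uniq q -> forall i, D q i = if i \in X then 0 else f i) ->
    0 < \sum_(i in ~: X) f i.
  move=> qE ux uy q6 xX yX x0 y0 DE.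
  have uq : uniq q.
    rewrite qE cat_uniq uy ux andbT; apply/hasPn => z /xX zX.
    by apply: contraL zX => /yX; rewrite in_setC.
  have tF : ~: [set z in q] \in F.
    case: x x0 xX {ux DE} qE => // x0 x _ xX; case: y y0 yX {uy} => // y0 y _ yX qE.
    apply: (coneF FE (x := x0) (y := y0)); rewrite ?qE.
    - by rewrite xX ?mem_head.
    - by rewrite mem_cat mem_head orbT.
    - by rewrite -in_setC yX ?mem_head.
    - by rewrite mem_head.
  have := pos _ tF (card_cone nd uq q6).
  rewrite ch_dotE pmulr_rgt0 ?invr_gt0 ?ltr0n // ltr0z.
  rewrite (eq_bigr _ (fun i _ => DE uq i)) (bigID (mem X)) /= big1 ?add0r; last first.
    by move=> i ->.
  congr (0 < _); apply: eq_big => [i|i /negbTE-> //]; by rewrite in_setC.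
have lt0 (f : 'I_n -> int) :
    0 < \sum_(i in ~: X) f i -> \sum_(i in ~: X) f i <= 0 -> False.
  by move=> /lt_le_trans h /h; rewrite ltxx.
have [Y4|Y3] := leqP 4 #|~: X|.
  have [y [uy y4 yX ymax]] := exists_largest a Y4.
  have /card_geqP[x [ux x2 xX]] := X2.
  apply: (lt0 (fun i => \sum_(k <- y) (a i - a k))).
    apply: (key (y ++ x) x y) => //; rewrite ?size_cat ?y4 ?x2 -?size_eq0 ?y4 ?x2 //.
    move=> uq; case: y y4 yX {uy ymax} uq => [|k1 [|k2 [|k3 [|k4 []]]]] // _ yX uq.
    case: x x2 xX {ux} uq => [|x1 [|x2 []]] // _ xX uq.
    apply: (quartic_linear nd degP FE relX relY uq) => //.
    - by apply/allP => z /yX; rewrite in_setC.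
    - by rewrite xX ?mem_head.
    - by rewrite xX ?inE ?eqxx ?orbT.
  apply: (sum_le0 uy yX) => [|i iX iy].
    (* The summand [a i - a k] is antisymmetric in [i] and [k], both ranging over [y]. *)
    by under eq_bigr do rewrite sumrB; rewrite sumrB exchange_big subrr.
  by rewrite big_seq; apply: sumr_le0 => k ky; rewrite subr_le0; apply: ymax.
(* The parts have [d + 2 >= 7] rays in all, so at most three outside [X] leave at least four in
   [X]. *)
have X4 : (3 < #|X|)%N by lia.
have [y [uy y2 yX ymax]] := exists_largest a Y2.
have /card_geqP[x [ux x4 xX]] := X4.
case: y y2 yX uy ymax => [|k [|l []]] // _ yX uy ymax.
pose f i := (a i - a k + (a i - a l)) * ((a i - a k) ^+ 2 + (a i - a l) ^+ 2).
apply: (lt0 f).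
  apply: (key ([:: k; l] ++ x) x [:: k; l]) => //; rewrite ?size_cat ?x4 -?size_eq0 ?x4 //.
  move=> uq; case: x x4 xX {ux} uq => [|x1 [|x2 [|x3 [|x4 []]]]] // _ xX uq.
  apply: (quartic_cubic nd degP FE relX relY uq) => //.
  - by rewrite -in_setC yX ?mem_head.
  - by rewrite -in_setC yX ?inE ?eqxx ?orbT.
  - exact/allP.
apply: (sum_le0 uy yX) => [|i iX iy].
  (* The term of [k] is [(a k - a l)^3] and that of [l] is its negative. *)
  by rewrite !big_cons big_nil /f; ring.
have ik : a i <= a k by apply: (ymax i iX iy); rewrite mem_head.
have il : a i <= a l by apply: (ymax i iX iy); rewrite !inE eqxx orbT.
rewrite /f mulr_le0_ge0 ?addr_ge0 ?sqr_ge0 //.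
by rewrite -[leRHS]addr0 lerD // subr_le0.
Qed.
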